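(* Let $R$ be a commutative ring with identity and let $M$ be an $R$-module. Then the following statements are equivalent: (a) $M$ is a fully idempotent $R$-module; (b) $M$ is a fully $(R-\mathfrak{p})$-idempotent $R$-module for each prime ideal $\mathfrak{p}$ of $R$; (c) $M$ is a fully $(R-\mathfrak{m})$-idempotent $R$-module for each maximal ideal $\mathfrak{m}$ of $R$; (d) $M$ is a fully $(R-\mathfrak{m})$-idempotent $R$-module for each maximal ideal $\mathfrak{m}$ of $R$ with $M_{\mathfrak{m}}\neq 0$.
   Context: For a submodule $N$ of an $R$-module $M$, $(N:_R M)=\{r\in R : rM\subseteq N\}$. A submodule $N$ of $M$ is idempotent if $N=(N:_R M)^2M$; $M$ is fully idempotent if every submodule of $M$ is idempotent. For a multiplicatively closed subset $S$ of $R$, a submodule $N$ of $M$ is an $S$-idempotent submodule if there exists $s\in S$ such that $sN\subseteq (N:_R M)^2M\subseteq N$; $M$ is fully $S$-idempotent if every submodule of $M$ is an $S$-idempotent submodule. $R-\mathfrak{p}$ denotes the set-theoretic complement of $\mathfrak{p}$ in $R$, and $M_{\mathfrak{m}}$ is the localization of $M$ at $\mathfrak{m}$. *)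

(* Defs.v *)
From HB Require Import structures.
From mathcomp Require Import all_boot all_order all_algebra.
From mathcomp Require Import generic_quotient ring.
From mathcomp Require Import boolp classical_sets.

Set Implicit Arguments.
Unset Strict Implicit.
Unset Printing Implicit Defensive.

Import GRing.Theory.
Local Open Scope ring_scope.
Local Open Scope classical_set_scope.
Local Open Scope quotient_scope.

Section Submodules.
Variables (R : comPzRingType) (M : lmodType R).

(* Submodules are arbitrary (not necessarily decidable) subsets of M;
   [in N] is the boolean predicate that boolp attaches to the set N. *)
Definition submodule (N : set M) : Prop := GRing.submod_closed [in N].

(* (N :_R M) *)
Definition colon (N : set M) : set R := [set r | forall x : M, N (r *: x)].

(* I N: the finite sums of products a y with a in I and y in N. *)
Definition smul_set (I : set R) (N : set M) : set M :=
  [set x | exists (n : nat) (a : 'I_n -> R) (y : 'I_n -> M),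
     [/\ forall i, I (a i), forall i, N (y i) & x = \sum_(i < n) a i *: y i]].

End Submodules.

Section Ideals.
Variable R : comPzRingType.

Definition ideal (I : set R) : Prop := submodule (I : set R^o).

Definition ideal_mul (I J : set R) : set R := smul_set I (J : set R^o).

Definition prime_ideal (p : set R) : Prop :=
  [/\ ideal p, p <> setT & forall a b : R, p (a * b) -> p a \/ p b].

Definition maximal_ideal (m : set R) : Prop :=
  [/\ ideal m, m <> setT &
      forall J : set R, ideal J -> m `<=` J -> J = m \/ J = setT].

Definition mult_closed (S : set R) : Prop := GRing.mulr_closed [in S].

End Ideals.

Section Idempotent.
Variables (R : comPzRingType) (M : lmodType R).

(* (N :_R M)^2 M *)
Definition colon_sq (N : set M) : set M :=
  smul_set (ideal_mul (colon N) (colon N)) [set: M].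

Definition idempotent_submodule (N : set M) : Prop := N = colon_sq N.

Definition S_idempotent_submodule (S : set R) (N : set M) : Prop :=
  exists s : R, [/\ S s, [set s *: x | x in N] `<=` colon_sq N
                  & colon_sq N `<=` N].

End Idempotent.

Definition fully_idempotent (R : comPzRingType) (M : lmodType R) : Prop :=
  forall N : set M, submodule N -> idempotent_submodule N.

(* Meant for multiplicatively closed S; cf. prime_setC_mult_closed and
   maximal_setC_mult_closed below. *)
Definition fully_S_idempotent (R : comPzRingType) (S : set R)
    (M : lmodType R) : Prop :=
  forall N : set M, submodule N -> S_idempotent_submodule S N.

Section IdealFacts.
Variable R : comPzRingType.
Implicit Types I p m : set R.

Lemma submoduleP (M : lmodType R) (N : set M) :
  submodule N <->
  N 0 /\ (forall (a : R) (x y : M), N x -> N y -> N (a *: x + y)).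
Proof.
split=> -[N0 NL]; split.
- by move: N0; rewrite inE.
- by move=> a x y Nx Ny; have := NL a x y; rewrite !inE; apply.
- by rewrite inE.
- by move=> a x y; rewrite !inE; apply: NL.
Qed.

Lemma idealP I :
  ideal I <-> I 0 /\ (forall a x y : R, I x -> I y -> I (a * x + y)).
Proof. exact: (@submoduleP R^o). Qed.

Lemma mult_closedP (S : set R) :
  mult_closed S <-> S 1 /\ (forall s t : R, S s -> S t -> S (s * t)).
Proof.
split=> -[S1 SM]; split.
- by move: S1; rewrite inE.
- by move=> s t Ss St; have := SM s t; rewrite !inE; apply.
- by rewrite inE.
- by move=> s t; rewrite !inE; apply: SM.
Qed.

Lemma ideal_proper1 I : ideal I -> I <> setT -> ~ I 1.
Proof.
move=> /idealP[I0 IL] IT I1; apply: IT; apply/seteqP; split=> // x _.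
by rewrite -[x]addr0 -[x]mulr1; apply: IL.
Qed.

Lemma prime_setC_mult_closed p : prime_ideal p -> mult_closed (~` p).
Proof.
move=> [idp pT pM]; apply/mult_closedP; split; first exact: ideal_proper1.
by move=> s t ps pt /pM[].
Qed.

Lemma maximal_prime m : maximal_ideal m -> prime_ideal m.
Proof.
move=> [idm mT mmax]; split=> // a b mab.
have /idealP[m0 mL] := idm.
have [|nma] := pselect (m a); [by left | right].
pose J : set R := [set z | exists x r, m x /\ z = x + r * a].
have idJ : ideal J.
  apply/idealP; split; first by exists 0, 0; rewrite mul0r addr0.
  move=> c _ _ [x [r [mx ->]]] [y [t [my ->]]].
  exists (c * x + y), (c * r + t); split; first exact: mL.
  by rewrite mulrDr mulrDl mulrA addrACA.
have mJ : m `<=` J by move=> x mx; exists x, 0; rewrite mul0r addr0.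
have [Jm|JT] := mmax J idJ mJ.
  by case: nma; rewrite -Jm; exists 0, 1; rewrite mul1r add0r.
have [x [r [mx e1]]] : J 1 by rewrite JT.
have -> : b = b * x + (r * (a * b) + 0).
  by rewrite addr0 mulrA [b * x]mulrC -mulrDl -e1 mul1r.
by apply: (mL) => //; apply: (mL).
Qed.

Lemma maximal_setC_mult_closed m : maximal_ideal m -> mult_closed (~` m).
Proof. by move=> /maximal_prime /prime_setC_mult_closed. Qed.

End IdealFacts.

(* The module of fractions S^-1 M, as an R-module: the quotient of M x S by
   (x, s) ~ (y, t) <-> u (t x) = u (s y) for some u in S. *)
Section Localization.
Variables (R : comPzRingType) (M : lmodType R) (S : set R).
Hypothesis S_mult : mult_closed S.

Definition loc_pair : Type := (M * {s : R | s \in S})%type.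
HB.instance Definition _ := Choice.on loc_pair.

Definition loc_rel (f g : loc_pair) : bool :=
  `[< exists2 u : R, S u & u *: (val g.2 *: f.1) = u *: (val f.2 *: g.1) >].

Let S1 : S 1. Proof. by have /mult_closedP[] := S_mult. Qed.
Let SM s t : S s -> S t -> S (s * t).
Proof. by have /mult_closedP[_] := S_mult; apply. Qed.
Let den (f : loc_pair) : S (val f.2). Proof. exact: set_mem (valP f.2). Qed.

Lemma loc_rel_refl : reflexive loc_rel.
Proof. by move=> f; apply/asboolP; exists 1. Qed.

Lemma loc_rel_sym : symmetric loc_rel.
Proof. by move=> f g; apply/asboolP/asboolP => -[u Su e]; exists u. Qed.

Lemma loc_rel_trans : transitive loc_rel.
Proof.
move=> g f h /asboolP[u Su e1] /asboolP[v Sv e2]; apply/asboolP.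
exists (u * v * val g.2); first by apply: SM; [apply: SM | apply: den].
move: e1 e2; rewrite !scalerA => e1 e2.
have -> : u * v * val g.2 * val h.2 = v * val h.2 * (u * val g.2).
  by rewrite [u * v]mulrC -!mulrA; congr (_ * _); rewrite mulrA mulrC.
rewrite -scalerA e1 scalerA.
have -> : v * val h.2 * (u * val f.2) = u * val f.2 * (v * val h.2).
  by rewrite mulrC.
rewrite -scalerA e2 scalerA; congr (_ *: _).
by rewrite -!mulrA; congr (_ * _); rewrite mulrC -!mulrA.
Qed.

Canonical loc_equiv := EquivRel loc_rel loc_rel_refl loc_rel_sym loc_rel_trans.

Definition localization : Type := {eq_quot loc_equiv}.
HB.instance Definition _ := EqQuotient.on localization.
HB.instance Definition _ := Choice.on localization.

Definition loc_den (s : R) (Ss : S s) : {s : R | s \in S} :=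
  exist _ s (mem_set Ss).

(* x / s *)
Definition loc_frac (x : M) (s : R) (Ss : S s) : localization :=
  \pi_localization (x, loc_den Ss).

Lemma loc_fracP x s (Ss : S s) y t (St : S t) :
  loc_frac x Ss = loc_frac y St <->
  exists2 u : R, S u & u *: (t *: x) = u *: (s *: y).
Proof. by split=> [/eqmodP/asboolP|e]; last by apply/eqmodP/asboolP. Qed.

Lemma loc_fracE (z : localization) :
  exists x s (Ss : S s), z = loc_frac x Ss.
Proof.
elim/quotW: z => -[x [s Ss]]; exists x, s, (set_mem Ss).
by apply/eqmodP/asboolP; exists 1.
Qed.

Definition loc_zero : localization := loc_frac 0 S1.

Definition loc_add (z w : localization) : localization :=
  let f := repr z in let g := repr w in
  loc_frac (val g.2 *: f.1 + val f.2 *: g.1) (SM (den f) (den g)).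

Definition loc_scale (a : R) (z : localization) : localization :=
  let f := repr z in loc_frac (a *: f.1) (den f).

Definition loc_opp (z : localization) : localization := loc_scale (-1) z.

Let repr_frac x s (Ss : S s) : let f := repr (loc_frac x Ss) in
  exists2 u : R, S u & u *: (s *: f.1) = u *: (val f.2 *: x).
Proof.
move=> f; have /eqmodP/asboolP[u Su e] : f = (x, loc_den Ss) %[mod localization].
  by rewrite reprK.
by exists u.
Qed.

Lemma loc_addE x s (Ss : S s) y t (St : S t) :
  loc_add (loc_frac x Ss) (loc_frac y St) =
  loc_frac (t *: x + s *: y) (SM Ss St).
Proof.
rewrite /loc_add /=.
have := repr_frac x Ss; have := repr_frac y St.
set g := repr _; set f := repr _ => /= -[v Sv e2] [u Su e1].
apply/loc_fracP; exists (u * v); first exact: SM.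
move: e1 e2; set a := val f.2; set b := val g.2 => e1 e2.
transitivity ((v * t * b) *: (u *: (s *: f.1)) +
              (u * s * a) *: (v *: (t *: g.1))).
  by rewrite !(scalerDr, scalerA); congr (_ *: _ + _ *: _); ring.
by rewrite e1 e2 !(scalerDr, scalerA); congr (_ *: _ + _ *: _); ring.
Qed.

Lemma loc_scaleE a x s (Ss : S s) :
  loc_scale a (loc_frac x Ss) = loc_frac (a *: x) Ss.
Proof.
have [u Su e] := repr_frac x Ss; apply/loc_fracP; exists u => //.
move: e; set f := repr _; set b := val f.2 => e.
transitivity (a *: (u *: (s *: f.1))).
  by rewrite !scalerA; congr (_ *: _); ring.
by rewrite e !scalerA; congr (_ *: _); ring.
Qed.

Lemma loc_frac_eq x s (Ss : S s) y t (St : S t) :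
  t *: x = s *: y -> loc_frac x Ss = loc_frac y St.
Proof. by move=> e; apply/loc_fracP; exists 1; rewrite ?e. Qed.

Let addA : associative loc_add.
Proof.
move=> z w k; have [x [s [Ss ->]]] := loc_fracE z.
have [y [t [St ->]]] := loc_fracE w; have [v [r [Sr ->]]] := loc_fracE k.
rewrite !loc_addE; apply: loc_frac_eq; rewrite !(scalerDr, scalerA) !addrA.
by congr (_ *: _ + _ *: _ + _ *: _); ring.
Qed.

Let addC : commutative loc_add.
Proof.
move=> z w; have [x [s [Ss ->]]] := loc_fracE z.
have [y [t [St ->]]] := loc_fracE w.
by rewrite !loc_addE; apply: loc_frac_eq; rewrite addrC [s * t]mulrC.
Qed.

Let add0 : left_id loc_zero loc_add.
Proof.
move=> z; have [x [s [Ss ->]]] := loc_fracE z.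
rewrite loc_addE; apply: loc_frac_eq.
by rewrite scaler0 add0r scale1r mul1r.
Qed.

Let addN : left_inverse loc_zero loc_opp loc_add.
Proof.
move=> z; have [x [s [Ss ->]]] := loc_fracE z.
rewrite /loc_opp loc_scaleE loc_addE; apply: loc_frac_eq.
by rewrite scaleN1r scalerN addNr !scaler0.
Qed.

HB.instance Definition _ :=
  GRing.isZmodule.Build localization addA addC add0 addN.

Lemma loc_fracD x s (Ss : S s) y t (St : S t) :
  loc_frac x Ss + loc_frac y St = loc_frac (t *: x + s *: y) (SM Ss St).
Proof. exact: loc_addE. Qed.

Let scaleA a b z : loc_scale a (loc_scale b z) = loc_scale (a * b) z.
Proof.
by have [x [s [Ss ->]]] := loc_fracE z; rewrite !loc_scaleE scalerA.
Qed.

Let scale1 : left_id 1 loc_scale.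
Proof.
by move=> z; have [x [s [Ss ->]]] := loc_fracE z; rewrite loc_scaleE scale1r.
Qed.

Let scaleDr : right_distributive loc_scale +%R.
Proof.
move=> a z w; have [x [s [Ss ->]]] := loc_fracE z.
have [y [t [St ->]]] := loc_fracE w.
rewrite loc_fracD !loc_scaleE loc_fracD; apply: loc_frac_eq.
by rewrite !(scalerDr, scalerA); congr (_ *: _ + _ *: _); ring.
Qed.

Let scaleDl z : {morph loc_scale^~ z : a b / a + b}.
Proof.
move=> a b; have [x [s [Ss ->]]] := loc_fracE z.
rewrite !loc_scaleE loc_fracD; apply: loc_frac_eq.
by rewrite scalerDl !(scalerDr, scalerA); congr (_ *: _ + _ *: _); ring.
Qed.

HB.instance Definition _ := GRing.Zmodule_isLmodule.Build R localization
  scaleA scale1 scaleDr scaleDl.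

Lemma loc_frac0 s (Ss : S s) : loc_frac 0 Ss = 0.
Proof. by apply: loc_frac_eq; rewrite !scaler0. Qed.

Lemma loc_frac_eq0 x s (Ss : S s) :
  loc_frac x Ss = 0 <-> exists2 u : R, S u & u *: x = 0.
Proof.
rewrite -(loc_frac0 S1); split=> [/loc_fracP|] [u Su e].
  by exists u => //; move: e; rewrite scale1r !scaler0.
by apply/loc_fracP; exists u; rewrite // scale1r !scaler0.
Qed.

End Localization.

(* M_m; the proof argument only serves to build the R-module structure. *)
Definition localization_at (R : comPzRingType) (M : lmodType R) (m : set R)
    (m_max : maximal_ideal m) : lmodType R :=
  localization M (maximal_setC_mult_closed m_max).

(* Main.v *)
Require Import Defs.
From mathcomp Require Import all_boot all_order all_algebra.
From mathcomp Require Import boolp classical_sets.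
Local Open Scope ring_scope.
Local Open Scope classical_set_scope.

(** For [x] in [N], the [r] with [r x] in [(N :_R M)^2 M] form an ideal [J].
    If [J] were proper it would lie in a maximal ideal [m]; but [J] meets the
    complement of [m]: by hypothesis if [M_m] is nonzero, and otherwise because
    some element outside [m] kills [x].  Hence [1] is in [J]. *)

Import GRing.Theory.

Set Implicit Arguments.
Unset Strict Implicit.

Section SubmoduleProducts.
Context {R : comPzRingType} {M : lmodType R}.
Implicit Types (I : set R) (N K : set M).

Lemma submoduleD N x y : submodule N -> N x -> N y -> N (x + y).
Proof. by move=> /submoduleP[_ NL] Nx Ny; rewrite -[x]scale1r; apply: NL. Qed.

Lemma submoduleZ N a x : submodule N -> N x -> N (a *: x).
Proof. by move=> /submoduleP[N0 NL] Nx; rewrite -[_ *: _]addr0; apply: NL. Qed.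

Lemma smul_set_sub I N K : submodule K ->
  (forall a y, I a -> N y -> K (a *: y)) -> smul_set I N `<=` K.
Proof.
move=> subK IN_K _ [n [a [y [Ia Ny ->]]]].
apply: big_ind => [|u v|i _]; last exact: IN_K.
- by have /submoduleP[] := subK.
- exact: submoduleD.
Qed.

(** Two finite sums are added by concatenating their families over ['I_(n + k)]. A scalar [c] is
    absorbed into the vectors, since [I] is an arbitrary set while [N] is stable under scaling. *)
Lemma smul_set_submodule I N : submodule N -> submodule (smul_set I N).
Proof.
move=> subN; apply/submoduleP; split.
  exists 0, (fun=> 0), (fun=> 0).
  by split=> [[]|[]|] //; rewrite big_ord0.
move=> c _ _ [n [a [y [Ia Ny ->]]]] [k [b [z [Ib Nz ->]]]].
exists (n + k)%N.
exists (fun i => match split i with inl j => a j | inr j => b j end).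
exists (fun i => match split i with inl j => c *: y j | inr j => z j end).
split=> [i|i|].
- by case: split.
- by case: split => // j; apply: submoduleZ.
- rewrite big_split_ord scaler_sumr /=; congr (_ + _); apply: eq_bigr => i _.
    by rewrite (unsplitK (inl i)) !scalerA mulrC.
  by rewrite (unsplitK (inr i)).
Qed.

Lemma setT_submodule : submodule [set: M].
Proof. by apply/submoduleP. Qed.

End SubmoduleProducts.

Section Colon.
Context {R : comPzRingType} {M : lmodType R}.
Implicit Types N : set M.

Lemma colon_sq_submodule N : submodule (colon_sq N).
Proof. exact/smul_set_submodule/setT_submodule. Qed.

Lemma colon_ideal N : submodule N -> ideal (colon N).
Proof.
move=> /submoduleP[N0 NL]; apply/idealP; split=> [x|a r s rN sN x].
  by rewrite scale0r.
by rewrite scalerDl -scalerA; apply: NL.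
Qed.

Lemma colon_sq_sub N : submodule N -> colon_sq N `<=` N.
Proof.
move=> subN; apply: smul_set_sub => // r x Ir _.
(* The square of [(N :_R M)] lies in [(N :_R M)], seen by treating [R] as a module over itself. *)
have /(_ r Ir) rN : ideal_mul (colon N) (colon N) `<=` colon N.
  apply: (@smul_set_sub R R^o); first exact: colon_ideal.
  by move=> a b _ bN; apply: (@submoduleZ R R^o) bN; apply: colon_ideal.
exact: rN.
Qed.

(** Applied to [colon_sq N], this provides the ideal [J] of the main argument. *)
Lemma transporter_ideal N x : submodule N -> ideal [set r | N (r *: x)].
Proof.
move=> /submoduleP[N0 NL]; apply/idealP; split=> [|a r s Nr Ns] /=.
  by rewrite scale0r.
by rewrite scalerDl -scalerA; apply: NL.
Qed.

End Colon.

Lemma ideal1_setT (R : comPzRingType) (I : set R) :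
  ideal I -> I 1 -> I = setT.
Proof. by move=> idI I1; apply: contrapT => /(ideal_proper1 idI). Qed.

(** Krull's theorem by Zorn's lemma. Properness is expressed as not containing [1], which passes to
    unions of chains. *)
Lemma maximal_ideal_exists (R : comPzRingType) (J : set R) :
  ideal J -> ~ J 1 -> exists2 m, maximal_ideal m & J `<=` m.
Proof.
move=> idJ J1.
(* [J `|` A] rather than [A], so that the union of the empty chain is allowed *)
pose P := [set A : set R | ideal (J `|` A) /\ ~ (J `|` A) 1].
have [F FP Ftot|A [[idA A1] Amax]] := @Zorn_bigcup R P.
  have [J0 JL] := (idealP J).1 idJ.
  split; last first.
    by case=> [//|[A FA A1]]; have [_] := FP _ FA; apply; right.
  apply/idealP; split; first by left.
  (* It is enough that both elements lie in [J] enlarged by a single member of the chain; of two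
     members, the larger one serves. *)
  have comb A : F A -> forall c x y, (J `|` A) x -> (J `|` A) y ->
      (J `|` \bigcup_(X in F) X) (c * x + y).
    move=> FA c x y xA yA; have [/idealP[_ AL] _] := FP _ FA.
    by case: (AL c x y xA yA) => [|Az]; [left | right; exists A].
  move=> c x y [Jx|[A FA Ax]] [Jy|[B FB By]].
  - by left; apply: JL.
  - by apply: (comb B) => //; [left | right].
  - by apply: (comb A) => //; [right | left].
  - have [AB|BA] := Ftot A B FA FB.
      by apply: (comb B) => //; right=> //; apply: AB.
    by apply: (comb A) => //; right=> //; apply: BA.
exists (J `|` A); last by move=> x; left.
split=> // [AT|K idK AK]; first by apply: A1; rewrite AT.
have [K1|K1] := pselect (K 1); first by right; apply: ideal1_setT.
have JK : J `|` K = K by apply/setUidPr => x Jx; apply: AK; left.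
(* A proper ideal [K] above [J] belongs to [P], so a point of [K] outside [A] would contradict the
   maximality of [A]. *)
left; apply/seteqP; split=> // x Kx; right.
apply: contrapT => nAx; apply: (Amax K); last by split; rewrite JK.
by split=> [y Ay|KA]; [apply: AK; right | apply: nAx; apply: KA].
Qed.

Lemma ideal1_maximal (R : comPzRingType) (J : set R) : ideal J ->
  (forall m, maximal_ideal m -> exists2 r, ~ m r & J r) -> J 1.
Proof.
move=> idJ Jm; apply: contrapT => /(maximal_ideal_exists idJ)[m m_max J_m].
by have [r mr /J_m] := Jm m m_max.
Qed.

Lemma fully_idempotent_fully_S_idempotent (R : comPzRingType) (M : lmodType R)
    (S : set R) : S 1 -> fully_idempotent M -> fully_S_idempotent S M.
Proof.
move=> S1 idemM N subN; exists 1; split=> //; last exact: colon_sq_sub.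
by move=> _ [x Nx <-]; rewrite scale1r -idemM.
Qed.

Unset Implicit Arguments.
Set Strict Implicit.

Theorem theorem2p10 (R : comPzRingType) (M : lmodType R) :
  [<-> (* (a) *) fully_idempotent M;
       (* (b) *) forall p : set R, prime_ideal p -> fully_S_idempotent (~` p) M;
       (* (c) *) forall m : set R, maximal_ideal m -> fully_S_idempotent (~` m) M;
       (* (d) *) forall (m : set R) (m_max : maximal_ideal m),
                   [set: localization_at M m_max] <> [set 0] ->
                   fully_S_idempotent (~` m) M].
Proof.
tfae.
- move=> idemM p [idp pT _].
  by apply: fully_idempotent_fully_S_idempotent => //; apply: ideal_proper1.
- by move=> Mp m /maximal_prime /Mp.
- by move=> Mm m m_max _; apply: Mm.
- move=> Mm N subN; apply/seteqP; split=> [x Nx|]; last exact: colon_sq_sub.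
  have subsq := colon_sq_submodule N.
  suff: [set r | colon_sq N (r *: x)] 1 by rewrite /= scale1r.
  apply: ideal1_maximal; first exact: transporter_ideal.
  move=> m m_max.
  (* When [M_m] is nonzero, the [s] outside [m] given by (d) sends all of [N], hence [x], into
     [colon_sq N]. *)
  have [Mm0|/(Mm m m_max)/(_ N subN)[s [ms sN _]]] :=
    pselect ([set: localization_at M m_max] = [set 0]); last first.
    by exists s => //; apply: sN; exists x.
  pose S_mult := maximal_setC_mult_closed m_max.
  have S1 : (~` m) 1 by have /mult_closedP[] := S_mult.
  (* When [M_m] is zero, the vanishing of [x / 1] yields [u] outside [m] with [u x = 0]. *)
  have /loc_frac_eq0[u mu ux0] : loc_frac S_mult x S1 = 0.
    have : [set: localization_at M m_max] (loc_frac S_mult x S1) by [].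
    by rewrite Mm0.
  by exists u => //=; rewrite ux0; have /submoduleP[] := subsq.
Qed.
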